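(* Let $M$ be a monotone Möbius structure on $X=S^1$ satisfying the Convexity Axiom (C). Then for any events $a,b\in\mathrm{aY}$ in the strong causal relation the function $F_{ab}:h_a\times h_b\to\mathbb R$ is strictly convex.
   Context: **Möbius structures.** $X=S^1$. A semi-metric on $X$ is a symmetric function $d:X^2\to\mathbb R\cup\{\infty\}$, positive off the diagonal, zero on it, with at most one infinitely remote point, i.e. a point $\omega_0$ with $d(x,\omega_0)=\infty$ for some (then, by requirement, for all) $x\ne\omega_0$. Two semi-metrics are Möbius equivalent if they have the same cross-ratios $\frac{d(x_1,x_3)d(x_2,x_4)}{d(x_1,x_4)d(x_2,x_3)}$ on all 4-tuples of pairwise distinct points; here and in all homogeneous (in)equalities below infinite distances cancel. A Möbius structure $M$ is a Möbius equivalence class of semi-metrics; $|xy|$ denotes the distance in any semi-metric from $M$. The $M$-topology has as subbase all open balls, centered at finite points, of semi-metrics in $M$ having an infinitely remote point. Two disjoint pairs of points of $X$ separate each other if the points of one lie in different components of the complement of the other. $M$ is monotone if (T) the $M$-topology is the usual topology of $S^1$, and (M) whenever $(x,y)$, $(z,u)$ separate each other, $|xy|\,|zu|>\max\{|xz|\,|yu|,|xu|\,|yz|\}$. **Convexity Axiom (C).** For pairwise distinct $x,y,z,p$ let $\delta_{x,y,z}(p)=\frac{|yp|^2}{|xp|\,|zp|}$ (computed in a semi-metric from $M$; comparisons of these quantities at two points $p,p'$ do not depend on its choice). For all pairwise distinct points $o',x,y,z,o,\omega\in X$ lying in this cyclic order on the circle (in one of the two directions): if $\delta_{x,y,z}(o)=\delta_{x,y,z}(o')$,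 then $\delta_{x,y,z}(o)>\delta_{x,y,z}(\omega)$. Equivalently, $\frac{|o'x|\,|yo|}{|xo|\,|o'y|}=\frac{|o'y|\,|zo|}{|yo|\,|o'z|}$ implies $\frac{|yo|\,|z\omega|}{|y\omega|\,|zo|}>\frac{|xo|\,|y\omega|}{|x\omega|\,|yo|}$. **Events, timelike lines, time determined by monotone $M$.** $\mathrm{aY}$ is the set of unordered pairs of distinct points of $X$ (events). Two events are in the strong causal relation if they are disjoint and do not separate each other. For $e=(z,u)$ the timelike line $h_e$ is the set of events $(x,y)$ with $x,y,z,u$ pairwise distinct and $|xz|\,|yu|=|xu|\,|yz|$; for each $x\in X\setminus e$ there is a unique event $x_e\in h_e$ containing $x$. For events $a=(z,u)$, $a'=(z',u')$ on $h_e$, $e=(x,y)$, the time is $t(a,a')=\left|\ln\frac{|xz'|\,|yz|}{|xz|\,|yz'|}\right|$. Each $h_e$ with $t$ is isometric to $\mathbb R$ with its standard metric; this gives $h_e$ an affine structure, and $h_a\times h_b$ is an affine space isomorphic to $\mathbb R\times\mathbb R$; (strict) convexity refers to this affine structure. **The function $F_{ab}$.** Let $a=(o,o')$, $b=(\omega,\omega')$ be in the strong causal relation, labelled so that $(o,\omega')$ and $(o',\omega)$ separate each other. Let $oo'$ be the open arc between $o,o'$ not containing $b$, and $\omega\omega'$ the open arc between $\omega,\omega'$ not containing $a$. Let $D_{ab}$ be the set of events $d=(x,x')$ with $x\in oo'$, $x'\in\omega\omega'$ (equivalently, events $d$ such that $(o,\omega)$ and $(o',\omega')$ lie in different open arcs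 of $X\setminus d$). Put $F_{ab}(d)=\frac12\big(t(o_d,\omega_d)+t(o'_d,\omega'_d)\big)$. The bijections $oo'\to h_a$, $x\mapsto x_a$, and $\omega\omega'\to h_b$, $x'\mapsto x'_b$, identify $D_{ab}$ with $h_a\times h_b$, and $F_{ab}$ is regarded as a function on $h_a\times h_b$. *)

(* Defs.v *)
From HB Require Import structures.
From mathcomp Require Import all_boot all_order all_algebra.
From mathcomp Require Import all_classical all_reals all_analysis.

Set Implicit Arguments.
Unset Strict Implicit.
Unset Printing Implicit Defensive.
Import Order.TTheory GRing.Theory Num.Theory.
Import numFieldNormedType.Exports.
Local Open Scope classical_set_scope.
Local Open Scope ring_scope.

(* The circle, as a subset of the plane.  Through the coercion [set_type] it is
   also a type, whose canonical topology is the one induced from the plane. *)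
Definition circle (R : realType) : set (R * R) :=
  [set p | p.1 ^+ 2 + p.2 ^+ 2 = 1].
Arguments circle : clear implicits.

Section SemiMetrics.
Context {R : realType}.
Implicit Types (d : circle R -> circle R -> \bar R) (x y z u : circle R).

Definition infinitely_remote d (w : circle R) :=
  forall x, x <> w -> d x w = +oo%E.

Definition semi_metric d :=
  [/\ forall x y, d x y = d y x,
      forall x, d x x = 0%E,
      forall x y, x <> y -> (0 < d x y)%E,
      forall x y, d x y = +oo%E -> infinitely_remote d x \/ infinitely_remote d y
    & forall w w', infinitely_remote d w -> infinitely_remote d w' -> w = w'].

(* The distance with infinite values replaced by 1.  It is only used in
   expressions that are homogeneous in each point, where this amounts to
   cancelling the infinite distances. *)
Definition dist d x y : R := if d x y == +oo%E then 1 else fine (d x y).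

Definition cross_ratio d x1 x2 x3 x4 : R :=
  (dist d x1 x3 * dist d x2 x4) / (dist d x1 x4 * dist d x2 x3).

Definition moebius_equiv d d' := forall x1 x2 x3 x4,
  uniq [:: x1; x2; x3; x4] ->
  cross_ratio d x1 x2 x3 x4 = cross_ratio d' x1 x2 x3 x4.

Definition moebius_structure (M : set (circle R -> circle R -> \bar R)) :=
  exists2 d0, semi_metric d0 & M = [set d | semi_metric d /\ moebius_equiv d0 d].

Definition M_subbase (M : set (circle R -> circle R -> \bar R)) :
    set (set (circle R)) :=
  [set B | exists d w x r, [/\ M d, infinitely_remote d w, x <> w, 0 < r
                             & B = [set y | (d x y < r%:E)%E]]].

(* Arbitrary unions of finite intersections of elements of the subbase. *)
Definition M_open (M : set (circle R -> circle R -> \bar R)) :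
    set (set (circle R)) :=
  [set \bigcup_(B in S) B | S in subset^~ (finI_from (M_subbase M) id)].

(* Unordered pairs of points are represented by the set of their elements. *)
Definition event (e : set (circle R)) := exists x y, x <> y /\ e = [set x; y].

Definition separate (a b : set (circle R)) :=
  a `&` b = set0 /\
  exists x y, [/\ a x, a y & ~ connected_component (~` b) x y].

Definition monotone_moebius (M : set (circle R -> circle R -> \bar R)) :=
  M_open M = open /\
  forall d, M d -> forall x y z u, separate [set x; y] [set z; u] ->
    dist d x y * dist d z u >
    Num.max (dist d x z * dist d y u) (dist d x u * dist d y z).

(* The points of s are distinct and are met in this order when running once
   counterclockwise around the circle. *)
Definition counterclockwise (s : seq (circle R)) :=
  exists th : seq R,
    [/\ [seq \val p | p <- s] = [seq (cos t, sin t) | t <- th],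
        sorted <%R th
      & {in th &, forall t t', t' < t + pi *+ 2}].

Definition cyclic_order (s : seq (circle R)) :=
  counterclockwise s \/ counterclockwise (rev s).

Definition delta d x y z p : R := dist d y p ^+ 2 / (dist d x p * dist d z p).

Definition convexity_axiom (M : set (circle R -> circle R -> \bar R)) :=
  forall d, M d -> forall o' x y z o w,
    uniq [:: o'; x; y; z; o; w] -> cyclic_order [:: o'; x; y; z; o; w] ->
    delta d x y z o = delta d x y z o' -> delta d x y z o > delta d x y z w.

Definition strong_causal (a b : set (circle R)) :=
  a `&` b = set0 /\ ~ separate a b.

Definition timelike d (e : set (circle R)) : set (set (circle R)) :=
  [set f | exists x y z u, [/\ uniq [:: x; y; z; u], e = [set z; u],
     f = [set x; y] & dist d x z * dist d y u = dist d x u * dist d y z]].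

(* The event written x_e: the element of the timelike line of e containing x. *)
Definition timelike_event d (e : set (circle R)) x : set (circle R) :=
  xget set0 [set f | timelike d e f /\ f x].

(* The value does not depend on the labellings e = {x, y}, z \in a, z' \in a'
   when a and a' are on the timelike line of e. *)
Definition time d (e a a' : set (circle R)) : R :=
  xget 0 [set tau | exists x y z z', [/\ e = [set x; y], a z, a' z'
    & tau = `| ln ((dist d x z' * dist d y z) / (dist d x z * dist d y z')) |]].

(* The component of the complement of a that does not meet b. *)
Definition arc_off (a b : set (circle R)) : set (circle R) :=
  [set x | ~ a x /\ connected_component (~` a) x `&` b = set0].

Definition F_ab d (o o' w w' : circle R) (e : set (circle R)) : R :=
  2^-1 * (time d e (timelike_event d e o) (timelike_event d e w) +
          time d e (timelike_event d e o') (timelike_event d e w')).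

(* F_ab transported to pairs (f, g) of events on the timelike lines of
   a = {o, o'} and b = {w, w'}, through the inverses of the bijections
   x |-> x_a and x' |-> x'_b on the two arcs. *)
Definition F_ab_lines d (o o' w w' : circle R) (f g : set (circle R)) : R :=
  let a := [set o; o'] in
  let b := [set w; w'] in
  F_ab d o o' w w'
    [set 'pinv_(fun=> o) (arc_off a b) (timelike_event d a) f;
         'pinv_(fun=> w) (arc_off b a) (timelike_event d b) g].

Definition isometric_parametrization d (e : set (circle R))
    (al : R -> set (circle R)) :=
  set_bij [set: R] (timelike d e) al /\
  forall s s', time d e (al s) (al s') = `|s - s'|.

Definition strictly_convex2 (G : R -> R -> R) :=
  forall s s' r r' l : R, (s, s') <> (r, r') -> 0 < l < 1 ->
    G ((1 - l) * s + l * r) ((1 - l) * s' + l * r') <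
    (1 - l) * G s s' + l * G r r'.

(* Strict convexity for the affine structure of h_a x h_b carried over from
   R x R by isometries.  Isometries of R being affine, the choice of al and be
   does not matter. *)
Definition strictly_convex_on_lines d (a b : set (circle R))
    (G : set (circle R) -> set (circle R) -> R) :=
  exists al be : R -> set (circle R),
    [/\ isometric_parametrization d a al, isometric_parametrization d b be
      & strictly_convex2 (fun s s' => G (al s) (be s'))].

End SemiMetrics.

(* Main.v *)
Require Import Defs.
From mathcomp Require Import all_boot all_order all_algebra.
From mathcomp Require Import all_classical all_reals all_analysis.
From mathcomp Require Import ring lra.
Import Order.TTheory GRing.Theory Num.Theory.
Import numFieldNormedType.Exports.
Local Open Scope classical_set_scope.
Local Open Scope ring_scope.

(* For x on the arc oo', put s = ln(|ox|/|o'x|); this is the time coordinate of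
   x_a on h_a.  By monotonicity the two times in F_ab(x, x') are logarithms of
   numbers greater than 1, so the absolute values can be removed and
     2 F_ab(x, x') = ln(|wx||w'x|/(|ox||o'x|)) + ln(|ox'||o'x'|/(|wx'||w'x'|)),
   a function of x plus a function of x'.  If s(y) is the midpoint of s(x) and
   s(z), then delta_{x,y,z}(o) = delta_{x,y,z}(o'), and the Convexity Axiom,
   applied once with w and once with w' as the sixth point, gives
     delta(w) delta(w') < delta(o) delta(o'),
   which is strict midpoint convexity of the first summand in s.  Monotonicity
   bounds this summand on segments, so it is strictly convex; the second
   summand is treated in the same way.  That s takes all real values follows
   from connectedness of the arcs, the balls of M being open. *)

(** * Angles, oriented area and the two arcs cut off by a chord *)

Section CircleGeometry.
Context {R : realType}.
Implicit Types (p q x y z u v : circle R) (s t : R).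

Lemma cos_sin_circle t : circle R (cos t, sin t).
Proof. exact: cos2Dsin2. Qed.

Definition expi t : circle R := SigSub (mem_set (cos_sin_circle t)).

Lemma val_expi t : \val (expi t) = (cos t, sin t).
Proof. by []. Qed.

Lemma circleP x : (\val x).1 ^+ 2 + (\val x).2 ^+ 2 = 1.
Proof. exact: set_valP x. Qed.

Lemma angle0 (c s : R) : c ^+ 2 + s ^+ 2 = 1 ->
  exists2 t, 0 <= t < pi *+ 2 & cos t = c /\ sin t = s.
Proof.
move=> cs1.
have c1 : -1 <= c <= 1 by apply/andP; split; nra.
have sE : Num.sqrt (1 - c ^+ 2) = `|s|.
  by rewrite -cs1 addrC addKr sqrtr_sqr.
have pi0 := pi_gt0 R.
have a0 := acos_ge0 c1; have api := acos_lepi c1.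
have cK : cos (acos c) = c by rewrite acosK.
have sK : sin (acos c) = `|s| by rewrite sin_acos.
have [s0|s0] := leP 0 s.
  exists (acos c); first by apply/andP; split; lra.
  by rewrite cK sK ger0_norm.
exists (- acos c + pi *+ 2).
  apply/andP; split; first lra.
  suff : acos c != 0 by move=> ?; lra.
  by apply/eqP => e; move: sK; rewrite e sin0 => /esym/eqP; rewrite normr_eq0; lra.
by rewrite cosD2pi sinD2pi cosN sinN cK sK ltr0_norm// opprK.
Qed.

Lemma angle s x : exists2 t, s <= t < s + pi *+ 2 & x = expi t.
Proof.
have xc := circleP x; have s1 := cos2Dsin2 s.
set a := (\val x).1 in xc; set b := (\val x).2 in xc.
(* Rotating [x] by [-s] gives this point; its angle in [[0, 2 pi[] is then shifted back by [s]. *)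
have [|t t02 [ct st]] := @angle0 (a * cos s + b * sin s) (b * cos s - a * sin s).
  transitivity ((a ^+ 2 + b ^+ 2) * (cos s ^+ 2 + sin s ^+ 2)); first by ring.
  by rewrite xc s1 mulr1.
exists (s + t); first lra.
apply: val_inj; rewrite val_expi cosD sinD ct st [LHS]surjective_pairing.
rewrite -/a -/b; congr pair.
  transitivity (a * (cos s ^+ 2 + sin s ^+ 2)); last by ring.
  by rewrite s1 mulr1.
transitivity (b * (cos s ^+ 2 + sin s ^+ 2)); last by ring.
by rewrite s1 mulr1.
Qed.

(* Twice the signed area of the triangle pqx. *)
Definition side p q x : R :=
  ((\val q).1 - (\val p).1) * ((\val x).2 - (\val p).2) -
  ((\val q).2 - (\val p).2) * ((\val x).1 - (\val p).1).

Lemma sideC p q x : side q p x = - side p q x.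
Proof. by rewrite /side; ring. Qed.

(** A sum-to-product formula. As long as the angle differences stay below a full turn, each
    half-angle sine has the sign of its difference, so orientation can be read off from angles
    alone. *)
Lemma side_expi a b t : side (expi a) (expi b) (expi t) =
  4 * sin ((b - a) / 2) * sin ((t - b) / 2) * sin ((t - a) / 2).
Proof.
have -> : side (expi a) (expi b) (expi t) =
    sin (b - a) + sin (t - b) - sin (t - a).
  by rewrite /side !val_expi/= !sinB; ring.
set g := (b - a) / 2; set h := (t - b) / 2.
have -> : b - a = g + g by rewrite /g; lra.
have -> : t - b = h + h by rewrite /h; lra.
have -> : t - a = (g + h) + (g + h) by rewrite /g /h; lra.
have -> : (g + h + (g + h)) / 2 = g + h by lra.
have := cos2Dsin2 g; have := cos2Dsin2 h; rewrite !(sinD, cosD).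
set x := sin g; set y := cos g; set z := sin h; set w := cos h => h1 h2.
have e1 : w ^+ 2 = 1 - z ^+ 2 by lra.
have e2 : y ^+ 2 = 1 - x ^+ 2 by lra.
transitivity (2 * x * y * (1 - w ^+ 2 + z ^+ 2) +
              2 * z * w * (1 + x ^+ 2 - y ^+ 2)); first by ring.
by rewrite e1 e2; ring.
Qed.

Lemma sin_half_sg t : - (pi *+ 2) < t < pi *+ 2 -> Num.sg (sin (t / 2)) = Num.sg t.
Proof.
move=> t2; case: (ltgtP t 0) => t0.
- rewrite (ltr0_sg t0) ltr0_sg// -[t]opprK mulNr sinN oppr_lt0 sin_gt0_pi//.
  by apply/andP; split; lra.
- rewrite (gtr0_sg t0) gtr0_sg// sin_gt0_pi//.
  by apply/andP; split; lra.
- by rewrite t0 mul0r sin0.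
Qed.

Lemma side_expi_sg a b t :
  `|b - a| < pi *+ 2 -> `|t - b| < pi *+ 2 -> `|t - a| < pi *+ 2 ->
  Num.sg (side (expi a) (expi b) (expi t)) =
  Num.sg ((b - a) * (t - b) * (t - a)).
Proof.
move=> h1 h2 h3; rewrite side_expi !sgrM !sin_half_sg -?ltr_norml//.
by rewrite gtr0_sg// mul1r.
Qed.

Lemma expi_periodic t : expi (t + pi *+ 2) = expi t.
Proof. by apply: val_inj; rewrite !val_expi cosD2pi sinD2pi. Qed.

Lemma expi_inj a b : `|b - a| < pi *+ 2 -> expi a = expi b -> a = b.
Proof.
rewrite ltr_norml => ba /(congr1 \val); rewrite !val_expi => -[ec es].
have e : cos (b - a) = 1 by rewrite cosB -ec -es -!expr2 cos2Dsin2.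
have : sin ((b - a) / 2) = 0.
  move: e; have -> : b - a = (b - a) / 2 + (b - a) / 2 by lra.
  rewrite cosD; have := cos2Dsin2 ((b - a) / 2).
  have -> : ((b - a) / 2 + (b - a) / 2) / 2 = (b - a) / 2 by lra.
  by move=> h1 h2; apply/eqP; rewrite -sqrf_eq0; apply/eqP; lra.
move=> /(congr1 Num.sg); rewrite sgr0 sin_half_sg// => /eqP.
by rewrite sgr_eq0; lra.
Qed.

(* Angles of finitely many points are compared within one turn, starting at a
   base angle s. *)
Definition turn s t := s <= t < s + pi *+ 2.

Lemma expi_inj_turn s a b : turn s a -> turn s b -> expi a = expi b -> a = b.
Proof.
by rewrite /turn => ha hb; apply: expi_inj; rewrite ltr_norml; apply/andP; split; lra.
Qed.

Lemma side_turn_sg s a b t : turn s a -> turn s b -> turn s t ->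
  Num.sg (side (expi a) (expi b) (expi t)) = Num.sg ((b - a) * (t - b) * (t - a)).
Proof.
rewrite /turn => ha hb ht.
by apply: side_expi_sg; rewrite ltr_norml; apply/andP; split; lra.
Qed.

Lemma side_turn_gt0 s a b t : turn s a -> turn s b -> turn s t ->
  (0 < side (expi a) (expi b) (expi t)) = (0 < (b - a) * (t - b) * (t - a)).
Proof. by move=> ha hb ht; rewrite -sgr_gt0 (side_turn_sg s)// sgr_gt0. Qed.

Lemma side_eq0 p q x : p <> q -> side p q x = 0 -> x = p \/ x = q.
Proof.
have [a a1 ->] := angle 0 p; have [b b1 ->] := angle 0 q.
have [t t1 ->] := angle 0 x => pq /(congr1 Num.sg).
rewrite (side_turn_sg 0)// sgr0 => /eqP; rewrite sgr_eq0 !mulf_eq0 !subr_eq0.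
move=> /orP[/orP[|]|] /eqP e.
- by case: pq; rewrite e.
- by right; rewrite e.
- by left; rewrite e.
Qed.

Lemma sidell p q : side p q p = 0.
Proof. by rewrite /side; ring. Qed.

Lemma siderr p q : side p q q = 0.
Proof. by rewrite /side; ring. Qed.

Lemma continuous_expi : continuous expi.
Proof.
apply/continuousP => _ [B oB <-]; rewrite -comp_preimage.
apply: open_comp oB => t _.
by apply: (@cvg_pair _ _ _ _ (nbhs (cos t)) (nbhs (sin t)));
  [exact: continuous_cos|exact: continuous_sin].
Qed.

Lemma open_side p q : open [set x | 0 < side p q x].
Proof.
pose f := fun r : R * R => ((\val q).1 - (\val p).1) * (r.2 - (\val p).2) -
  ((\val q).2 - (\val p).2) * (r.1 - (\val p).1).
exists (f @^-1` [set r | 0 < r]) => //.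
apply: open_comp; last exact: open_gt.
by move=> r _; apply: cvgB; apply: cvgMl_tmp; apply: cvgB;
  [exact: cvg_snd|exact: cvg_cst|exact: cvg_fst|exact: cvg_cst].
Qed.

(** With [p] at angle [s] and [q] at angle [a], the sign of [side] at angle [t] is that of
    [(a - s) (t - a) (t - s)], which is positive exactly past [a]. The positive side is thus the arc
    run counterclockwise from [q] to [p]. *)
Lemma arc_expi p q : p <> q -> exists s a,
  [/\ s < a < s + pi *+ 2, p = expi s, q = expi a &
      [set x | 0 < side p q x] = expi @` `]a, s + pi *+ 2[].
Proof.
move=> pq; have [s _ ps] := angle 0 p; have [a a1 qa] := angle s q.
have pi0 := pi_gt0 R.
have sa : s != a by apply/eqP => e; apply: pq; rewrite ps qa e.
exists s, a; split=> //; first lra.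
have ss : turn s s by rewrite /turn; lra.
apply/seteqP; split=> [x /=|_ /= [t /[!in_itv]/= t1 <-]].
  have [t t1 ->] := angle s x; rewrite ps qa (side_turn_gt0 s)// => h.
  exists t => //=; rewrite in_itv/=; apply/andP; split; last lra.
  rewrite ltNge; apply/negP => ta; move: h.
  by apply/negP; rewrite -leNgt; apply: mulr_le0_ge0; [apply: mulr_ge0_le0|]; lra.
rewrite ps qa (side_turn_gt0 s)//; last by rewrite /turn; lra.
by rewrite !mulr_gt0//; lra.
Qed.

Lemma connected_side p q : p <> q -> connected [set x | 0 < side p q x].
Proof.
move=> /arc_expi[s [a [_ _ _ ->]]]; apply: connected_continuous_connected.
  exact/connected_intervalP/interval_is_interval.
by apply: continuous_subspaceT => x; exact: continuous_expi.
Qed.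

Lemma side_near p q (U : set (circle R)) : p <> q -> open U -> U p \/ U q ->
  exists2 x, U x & 0 < side p q x.
Proof.
move=> /arc_expi[s [a [sa -> -> arcE]]] oU Upq.
have oV : open (expi @^-1` U) by apply: open_comp oU => t _; exact: continuous_expi.
have [t [t1 Ut]] : exists t, a < t < s + pi *+ 2 /\ U (expi t).
  case: Upq => [|Ua].
    (* The point [p] is taken at angle [s + 2 pi], the end from which the open arc approaches it. *)
    rewrite -expi_periodic => Us.
    have Vs : \forall t \near (s + pi *+ 2)^'-, (expi @^-1` U) t.
      exact/cvg_within/open_nbhs_nbhs.
    have near_t : \forall t \near (s + pi *+ 2)^'-,
        (expi @^-1` U) t /\ a < t < s + pi *+ 2.
      near=> t.
      split; first by near: t.
      apply/andP; split; near: t.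
        by apply: nbhs_left_gt; lra.
      exact: nbhs_left_lt.
    by have [t []] := @filter_ex _ _ (at_left_proper_filter _) _ near_t; exists t.
  have Va : \forall t \near a^'+, (expi @^-1` U) t.
    exact/cvg_within/open_nbhs_nbhs.
  have near_t : \forall t \near a^'+,
      (expi @^-1` U) t /\ a < t < s + pi *+ 2.
    near=> t.
    split; first by near: t.
    apply/andP; split; near: t.
      exact: nbhs_right_gt.
    by apply: nbhs_right_lt; lra.
  by have [t []] := @filter_ex _ _ (at_right_proper_filter _) _ near_t; exists t.
exists (expi t) => //.
suff : [set x | 0 < side (expi s) (expi a) x] (expi t) by [].
by rewrite arcE; exists t => //=; rewrite in_itv.
Unshelve. all: by end_near. Qed.

Lemma side_neq p q x : side p q x != 0 -> [/\ p <> q, x <> p & x <> q].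
Proof.
move=> h; split=> e; move: h; rewrite e.
- by rewrite /side !subrr !mul0r subrr eqxx.
- by rewrite sidell eqxx.
- by rewrite siderr eqxx.
Qed.

Lemma side_neq0 p q x : p <> q -> x <> p -> x <> q -> side p q x != 0.
Proof. by move=> pq xp xq; apply/eqP => /(side_eq0 _ _ _ pq)[]. Qed.

(** Each side of the chord is an open connected arc, and the two sides fill the complement of
    [{p, q}]. They are therefore its components, which turns [separate] and [arc_off] into sign
    conditions. *)
Lemma component_side p q x y : side p q x != 0 ->
  connected_component (~` [set p; q]) x y <-> 0 < side p q x * side p q y.
Proof.
wlog x0 : p q / 0 < side p q x => [hw|].
  rewrite neq_lt => /orP[x0|x0].
    rewrite setUC -mulrNN -!(sideC p q).
    by apply: hw; rewrite sideC ?oppr_gt0 ?oppr_eq0 ?lt_eqF.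
  by apply: hw; rewrite ?gt_eqF.
move=> /side_neq[pq _ _]; rewrite pmulr_rgt0//; split=> [[C [Cx Cpq cC] Cy]|y0].
  (* The positive side is open and closed in [C], because [C] avoids the only zeros [p] and [q] of
     [side]. *)
  suff /seteqP[_ /(_ _ Cy)[]] : C `&` [set z | 0 < side p q z] = C by [].
  apply: cC; first by exists x.
    by exists [set z | 0 < side p q z] => //; exact: open_side.
  exists (~` [set z | 0 < side q p z]); first exact/open_closedC/open_side.
  apply/seteqP; split=> z /= [Cz z0]; split=> //; rewrite sideC oppr_gt0 in z0 *.
    by apply/negP; rewrite -leNgt ltW// -oppr_gt0 -sideC.
  have /orP[//|] : (0 < side p q z) || (side p q z < 0).
    rewrite -neq_lt eq_sym; apply: side_neq0 => // e; apply: (Cpq _ Cz);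
    rewrite e; first [by left|by right].
  by move/z0.
exists [set z | 0 < side p q z] => //; split=> //; last exact: connected_side.
by move=> z /= z0 [] e; move: z0; rewrite e ?sidell ?siderr ltxx.
Qed.

Lemma separate_side x y z u : uniq [:: x; y; z; u] ->
  separate [set x; y] [set z; u] <-> side z u x * side z u y < 0.
Proof.
rewrite /= !inE !negb_or => /and4P[/and3P[/eqP xy /eqP xz /eqP xu] /andP[/eqP yz /eqP yu] /eqP zu _].
have x0 : side z u x != 0 by exact: side_neq0.
have y0 : side z u y != 0 by exact: side_neq0.
split=> [[_ [v [v' [vxy v'xy vv']]]]|xy0].
  have : ~ 0 < side z u v * side z u v'.
    by move/component_side => h; apply/vv'/h; case: vxy => ->.
  case: vxy => ->; case: v'xy => -> /negP.
  - by rewrite -expr2 exprn_even_gt0//= x0.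
  - by rewrite -leNgt le_eqVlt mulf_eq0 (negPf x0) (negPf y0).
  - by rewrite mulrC -leNgt le_eqVlt mulf_eq0 (negPf x0) (negPf y0).
  - by rewrite -expr2 exprn_even_gt0//= y0.
split.
  by apply/seteqP; split=> // v [[->|->] [|]].
exists x, y; split; [by left|by right|].
by move/(component_side _ _ _ _ x0); rewrite ltNge ltW.
Qed.

End CircleGeometry.

(** * Cyclic order, separation and angles within one turn *)

Section CyclicOrder.
Context {R : realType}.
Implicit Types (p q x y z u v o w : circle R) (s t : R).

Lemma angle_from s x : x <> expi s ->
  exists2 t, s < t < s + pi *+ 2 & x = expi t.
Proof.
have [t t1 ->] := angle s x => ts; exists t => //.
suff : s != t by lra.
by apply/eqP => e; apply: ts; rewrite e.
Qed.

Lemma turn_base s : turn s s.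
Proof. by have := pi_gt0 R; rewrite /turn; lra. Qed.

Lemma turnW s t : s < t < s + pi *+ 2 -> turn s t.
Proof. by rewrite /turn; lra. Qed.

Lemma uniq_expi s (th : seq R) : all (turn s) th ->
  uniq [seq expi t | t <- th] = uniq th.
Proof.
move=> /allP sth; apply: map_inj_in_uniq => a b /sth ha /sth hb.
exact: (expi_inj_turn s).
Qed.

(** All angles lie in the turn that starts at the first of them, so one base angle replaces the
    pairwise bound. *)
Lemma counterclockwiseP (l : seq (circle R)) : l != [::] -> counterclockwise l <->
  exists s th, [/\ l = [seq expi t | t <- th], sorted <%R th & all (turn s) th].
Proof.
move=> l0; split=> [[th [lth thS thpi]]|[s [th [-> thS /allP sth]]]].
  have lE : l = [seq expi t | t <- th].
    apply: (inj_map val_inj); rewrite lth -map_comp; exact: eq_map.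
  case: th lth lE thS thpi => [|s th] _ lE thS thpi; first by rewrite lE in l0.
  exists s, (s :: th); split=> //; apply/allP => t tth.
  rewrite /turn thpi// ?mem_head// andbT.
  move: tth; rewrite inE => /predU1P[->//|tth].
  by move: thS => /= /(order_path_min lt_trans)/allP/(_ _ tth)/ltW.
exists th; split=> //; first by rewrite -map_comp; exact: eq_map.
by move=> t t' /sth + /sth; rewrite /turn; lra.
Qed.

Lemma counterclockwise_turn s (th : seq R) : th != [::] ->
  all (turn s) th -> sorted <%R th -> counterclockwise [seq expi t | t <- th].
Proof.
move=> th0 sth thS; apply/counterclockwiseP.
  by move: th0; rewrite -!size_eq0 size_map.
by exists s, th.
Qed.

Lemma counterclockwise_uniq (l : seq (circle R)) : l != [::] ->
  counterclockwise l -> uniq l.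
Proof.
move=> l0 /(counterclockwiseP _ l0)[s [th [-> thS sth]]].
by rewrite (uniq_expi s)// lt_sorted_uniq.
Qed.

Lemma cyclic_order_uniq (l : seq (circle R)) : l != [::] ->
  cyclic_order l -> uniq l.
Proof.
move=> l0 [|]; first exact: counterclockwise_uniq.
rewrite -rev_uniq; apply: counterclockwise_uniq.
by rewrite -size_eq0 size_rev size_eq0.
Qed.

Lemma counterclockwise_subseq (l l' : seq (circle R)) : subseq l' l ->
  counterclockwise l -> counterclockwise l'.
Proof.
move=> /subseqP[m ml ->] [th [lth thS thpi]]; exists (mask m th).
split; first by rewrite !map_mask lth.
  exact: sorted_mask lt_trans _ _ thS.
by move=> t t' /mem_mask + /mem_mask; apply: thpi.
Qed.

Lemma cyclic_order_subseq (l l' : seq (circle R)) : subseq l' l ->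
  cyclic_order l -> cyclic_order l'.
Proof.
move=> ll' [|] h; [left|right]; apply: counterclockwise_subseq h => //.
by rewrite subseq_rev.
Qed.

Lemma counterclockwise_separate p x q y : counterclockwise [:: p; x; q; y] ->
  separate [set p; q] [set x; y] /\ separate [set x; y] [set p; q].
Proof.
move/counterclockwiseP => /(_ isT)[s [th []]].
case: th => [|t1 [|t2 [|t3 [|t4 [|//]]]]]//= [-> -> -> ->].
move=> /and4P[t12 t23 t34 _] /and5P[h1 h2 h3 h4 _].
split; apply/separate_side.
- rewrite -[X in uniq X]/([seq expi t | t <- [:: t1; t3; t2; t4]]) (uniq_expi s).
    by rewrite /= !inE; lra.
  by apply/and5P.
- rewrite -sgr_lt0 sgrM !(side_turn_sg s)// -sgrM sgr_lt0.
  (* Both areas contain the chord factor [t4 - t2], hence the square; every other factor is written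
     as a later angle minus an earlier one. *)
  rewrite (_ : _ * _ = - ((t4 - t2) ^+ 2 * ((t4 - t1) * (t2 - t1)) *
    ((t4 - t3) * (t3 - t2)))); last by ring.
  by rewrite oppr_lt0 !mulr_gt0 ?exprn_gt0 ?subr_gt0//; lra.
- rewrite -[X in uniq X]/([seq expi t | t <- [:: t2; t4; t1; t3]]) (uniq_expi s).
    by rewrite /= !inE; lra.
  by apply/and5P.
- rewrite -sgr_lt0 sgrM !(side_turn_sg s)// -sgrM sgr_lt0.
  rewrite (_ : _ * _ = - ((t3 - t1) ^+ 2 * ((t4 - t1) * (t2 - t1)) *
    ((t3 - t2) * (t4 - t3)))); last by ring.
  by rewrite oppr_lt0 !mulr_gt0 ?exprn_gt0 ?subr_gt0//; lra.
Qed.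

(** Reversing the list exchanges the roles of the two pairs, which is why the counterclockwise case
    was proved with both separations. *)
Lemma cyclic_order_separate p x q y : cyclic_order [:: p; x; q; y] ->
  separate [set p; q] [set x; y].
Proof.
by move=> [|] /counterclockwise_separate[// _]; rewrite setUC [[set x; y]]setUC.
Qed.

Lemma between (a b c : R) : (b - a) * (b - c) < 0 -> a < b < c \/ c < b < a.
Proof.
move=> h; case: (ltgtP a b) => ab; last by move: h; rewrite ab; lra.
  by left; apply/andP; split=> //; move: h; rewrite pmulr_rlt0; lra.
by right; apply/andP; split=> //; move: h; rewrite nmulr_rlt0; lra.
Qed.

Lemma side_base s a t t' : s < a < s + pi *+ 2 ->
  s < t < s + pi *+ 2 -> s < t' < s + pi *+ 2 ->
  Num.sg (side (expi s) (expi a) (expi t) * side (expi s) (expi a) (expi t')) =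
  Num.sg ((t - a) * (t' - a)).
Proof.
move=> ha ht ht'; rewrite sgrM !(side_turn_sg s) ?turn_base ?turnW// !sgrM.
rewrite !(@gtr0_sg _ (_ - s)) ?mulr1 ?mul1r//; lra.
Qed.

(** Cutting the circle at [expi s] leaves an interval of angles, on which separation becomes
    betweenness: [b] lies strictly between [a] and [c]. *)
Lemma separate_base s a b c : s < a < s + pi *+ 2 ->
  s < b < s + pi *+ 2 -> s < c < s + pi *+ 2 -> uniq [:: a; b; c] ->
  separate [set expi s; expi b] [set expi a; expi c] <-> (b - a) * (b - c) < 0.
Proof.
move=> ha hb hc; rewrite /= !inE !negb_or !andbT => /andP[/andP[ab ac] bc].
rewrite separate_side; last first.
  rewrite -[X in uniq X]/([seq expi t | t <- [:: s; b; a; c]]) (uniq_expi s).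
    by rewrite /= !inE; lra.
  by rewrite /= turn_base !turnW.
rewrite -sgr_lt0 sgrM !(side_turn_sg s) ?turn_base ?turnW// -sgrM sgr_lt0.
rewrite [X in X < 0 <-> _](_ : _ = ((c - a) ^+ 2 * ((s - c) * (s - a))) * ((b - a) * (b - c)));
  last by ring.
rewrite pmulr_rlt0// mulr_gt0//; first by rewrite exprn_even_gt0//=; lra.
by rewrite nmulr_rgt0; lra.
Qed.

(** Two points on one arc come in one of two orders. The order [p, x, y, q] is encoded as the
    separation of [{p, y}] and [{x, q}], the form in which monotonicity applies. *)
Lemma side_order p q x y : x <> y -> 0 < side p q x * side p q y ->
  separate [set p; y] [set x; q] \/ separate [set p; x] [set y; q].
Proof.
have [s _ ->] := angle 0 p => xy h.
have : side (expi s) q x * side (expi s) q y != 0 by rewrite gt_eqF.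
rewrite mulf_eq0 negb_or => /andP[/side_neq[/nesym qs xs xq] /side_neq[_ ys yq]].
move: qs xs ys => /angle_from[a a1 qa] /angle_from[b b1 xb] /angle_from[c c1 yc].
subst q x y; move: h; rewrite -sgr_gt0 side_base// sgr_gt0 => h.
have ab : b <> a by congruence.
have ac : c <> a by congruence.
have bc : b <> c by congruence.
move: ab ac bc => /eqP ab /eqP ac /eqP bc.
clear xy xq yq.
have u1 : uniq [:: b; c; a] by rewrite /= !inE; lra.
have u2 : uniq [:: c; b; a] by rewrite /= !inE; lra.
rewrite (separate_base s b c a)// (separate_base s c b a)//.
have [[a_b a_c]|[b_a c_a]] : (a < b /\ a < c) \/ (b < a /\ c < a).
  have [ab'|ab'] := ltP a b.
    by left; split=> //; move: h; rewrite pmulr_rgt0; lra.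
  by right; split; [lra|move: h; rewrite nmulr_rgt0; lra].
- have [bc'|bc'] := ltP b c; [right|left]; nra.
- have [bc'|bc'] := ltP b c; [left|right]; nra.
Qed.

End CyclicOrder.

(** * Cyclic orders of six points *)

Section SixPoints.
Context {R : realType}.
Implicit Types (p q x y z u v o w : circle R) (s t : R).

Lemma separate_uniq x y z u : x <> y -> z <> u ->
  separate [set x; y] [set z; u] -> uniq [:: x; y; z; u].
Proof.
move=> /eqP xy /eqP zu [/seteqP[xyzu _] _].
have h v : [set x; y] v -> v != z /\ v != u.
  by move=> vxy; split; apply/eqP => e; apply: (xyzu v); split=> //; [left|right].
have [xz xu] := h x (or_introl erefl); have [yz yu] := h y (or_intror erefl).
by rewrite /= !inE !negb_or xy xz xu yz yu zu.
Qed.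

Lemma side_lt0_neq p q x v : side p q x * side p q v < 0 ->
  [/\ p <> q, x <> p, x <> q, v <> p & v <> q].
Proof.
move=> h; have : side p q x * side p q v != 0 by rewrite lt_eqF.
by rewrite mulf_eq0 negb_or => /andP[/side_neq[pq xp xq] /side_neq[_ vp vq]].
Qed.

(** The two separations order [x, y, z] along their arc from [p] to [q], and [v] lies on the other
    arc. This produces the configuration of the Convexity Axiom. *)
Lemma cyclic_order_arc p q x y z v :
  side p q x * side p q v < 0 -> side p q y * side p q v < 0 ->
  side p q z * side p q v < 0 ->
  separate [set p; y] [set x; q] -> separate [set p; z] [set y; q] ->
  cyclic_order [:: p; x; y; z; q; v].
Proof.
move=> hx hy hz.
have [/nesym qp xp xq vp vq] := side_lt0_neq _ _ _ _ hx.
have [_ yp yq _ _] := side_lt0_neq _ _ _ _ hy.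
have [_ zp zq _ _] := side_lt0_neq _ _ _ _ hz.
move=> sxy syz.
have := separate_uniq _ _ _ _ (nesym yp) xq sxy.
have := separate_uniq _ _ _ _ (nesym zp) yq syz.
have [s _ ps] := angle 0 p; subst p.
move: qp xp vp yp zp => /angle_from[a a1 qa] /angle_from[b b1 xb] /angle_from[f f1 vf].
move=> /angle_from[c c1 yc] /angle_from[e e1 ze]; subst q x y z v.
rewrite -/(map expi [:: s; e; c; a]) -/(map expi [:: s; c; b; a]).
rewrite !(uniq_expi s) /= ?turn_base ?turnW// !inE => u1 u2.
clear xq vq yq zq.
have {}u1 : uniq [:: c; e; a] by move: u1; rewrite /= !inE; lra.
have {}u2 : uniq [:: b; c; a] by move: u2; rewrite /= !inE; lra.
move: sxy syz hx; rewrite (separate_base s b c a)// (separate_base s c e a)//.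
move=> /between[] sxy /between[] syz; try lra;
  rewrite -sgr_lt0 side_base// sgr_lt0 => h.
- left; apply: (@counterclockwise_turn _ s [:: s; b; c; e; a; f]) => //=.
    by rewrite turn_base !turnW.
  suff : a < f by lra.
  by rewrite -subr_gt0; move: h; rewrite nmulr_rlt0; lra.
(* In the clockwise case the reversed list starts at [v], so the turn is based at [f] and [p] moves
   to angle [s + 2 pi]. *)
- right; rewrite -(expi_periodic s).
  have h' : f < a by rewrite -subr_lt0; move: h; rewrite pmulr_rlt0; lra.
  apply: (@counterclockwise_turn _ f [:: f; a; e; c; b; s + pi *+ 2]) => //=.
    by rewrite /turn; lra.
  lra.
Qed.

(** The labelling forces the cyclic order [o, o', w', w], so neither of the chords [oo'] and [ww']
    cuts the ends of the other apart. *)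
Lemma crossed_side o o' w w' : uniq [:: o; o'; w; w'] ->
  separate [set o; w'] [set o'; w] ->
  0 < side o o' w * side o o' w' /\ 0 < side w w' o * side w w' o'.
Proof.
have [s _ ->] := angle 0 o => + sep.
rewrite /= !inE !negb_or.
move=> /and4P[/and3P[/eqP/nesym + /eqP/nesym + /eqP/nesym +]].
move=> /angle_from[a a1 oa] /angle_from[b b1 wb] /angle_from[c c1 wc].
subst o' w w' => /andP[ab ac] bc _.
have abc : uniq [:: a; c; b].
  rewrite -(uniq_expi s) /= ?turnW// !inE negb_or ab ac /= andbT.
  by rewrite eq_sym.
move: sep; rewrite (separate_base s a c b)// => /between h.
have cb : 0 < (c - b) ^+ 2 by rewrite exprn_even_gt0//= subr_eq0; case: h => h; lra.
split; first by rewrite -sgr_gt0 side_base// sgr_gt0; case: h => h; nra.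
rewrite -sgr_gt0 sgrM !(side_turn_sg s) ?turn_base ?turnW// -sgrM sgr_gt0.
rewrite [X in 0 < X](_ : _ = ((c - b) ^+ 2 * ((c - s) * (b - s))) * ((a - c) * (a - b)));
  last by ring.
rewrite mulr_gt0//; last by case: h => h; [rewrite nmulr_rgt0|rewrite pmulr_rgt0]; lra.
by apply: mulr_gt0 => //; apply: mulr_gt0; lra.
Qed.

Lemma cyclic_order_crossed o o' w w' x x' : uniq [:: o; o'; w; w'] ->
  separate [set o; w'] [set o'; w] ->
  side o o' x * side o o' w < 0 -> side w w' x' * side w w' o < 0 ->
  cyclic_order [:: o; x; o'; w'; x'; w].
Proof.
have [s _ ->] := angle 0 o => + sep hx hx'.
rewrite /= !inE !negb_or.
move=> /and4P[/and3P[/eqP/nesym + /eqP/nesym + /eqP/nesym +]].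
have [_ + _ _ _] := side_lt0_neq _ _ _ _ hx.
move=> /angle_from[e e1 xe].
have x's : x' <> expi s.
  by move=> e'; move: hx'; rewrite e' -expr2 ltNge sqr_ge0.
move: x's => /angle_from[f f1 xf].
move=> /angle_from[a a1 oa] /angle_from[b b1 wb] /angle_from[c c1 wc].
subst o' w w' x x' => /andP[ab ac] bc _.
have abc : uniq [:: a; c; b].
  rewrite -(uniq_expi s) /= ?turnW// !inE negb_or ab ac /= andbT.
  by rewrite eq_sym.
move: sep hx hx'; rewrite (separate_base s a c b)// => /between h.
have cb : 0 < (c - b) ^+ 2 by rewrite exprn_even_gt0//= subr_eq0; case: h => h; lra.
rewrite -sgr_lt0 side_base// sgr_lt0 => hx.
rewrite -sgr_lt0 sgrM !(side_turn_sg s) ?turn_base ?turnW// -sgrM sgr_lt0.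
rewrite [X in X < 0 -> _](_ : _ = ((c - b) ^+ 2 * ((c - s) * (b - s))) * ((f - c) * (f - b)));
  last by ring.
rewrite pmulr_rlt0; last by apply: mulr_gt0 => //; apply: mulr_gt0; lra.
move=> /between hx'.
case: h => h; case: hx' => hx'; try lra.
- left; apply: (@counterclockwise_turn _ s [:: s; e; a; c; f; b]) => //=.
    by rewrite turn_base !turnW.
  suff : e < a by lra.
  by rewrite -subr_lt0; move: hx; rewrite pmulr_llt0; lra.
- right; rewrite -(expi_periodic s).
  have h' : a < e by rewrite -subr_gt0; move: hx; rewrite nmulr_llt0; lra.
  apply: (@counterclockwise_turn _ b [:: b; f; c; a; e; s + pi *+ 2]) => //=.
    by rewrite /turn; lra.
  lra.
Qed.

End SixPoints.

(** * From midpoint convexity and local upper bounds to strict convexity *)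

Section MidpointConvexity.
Context {R : realType}.

(* Bernstein and Doetsch: the supremum S on [0, 1] of a midpoint convex
   function vanishing at 0 and 1 satisfies S <= S / 2. *)
Lemma midpoint_convex_le0 (f : R -> R) (K : R) : f 0 = 0 -> f 1 = 0 ->
  (forall l m, 0 <= l <= 1 -> 0 <= m <= 1 -> f ((l + m) / 2) <= (f l + f m) / 2) ->
  (forall l, 0 <= l <= 1 -> f l <= K) ->
  forall l, 0 <= l <= 1 -> f l <= 0.
Proof.
move=> f0 f1 fmid fK l l01.
pose E := [set f m | m in [set m | 0 <= m <= 1]].
have E_sup : has_sup E.
  split; first by exists (f 0), 0 => //=; lra.
  by exists K => _ [m /= m01 <-]; exact: fK.
have f_sup m : 0 <= m <= 1 -> f m <= sup E.
  by move=> m01; apply: ub_le_sup; [exact: E_sup.2|exists m].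
suff : sup E <= sup E / 2 by have := f_sup _ l01; lra.
apply: ge_sup; first exact: E_sup.1.
(* [m] is the midpoint of [0] and [2 m], or of [2 m - 1] and [1]; the end of the interval
   contributes the value 0. *)
move=> _ [m /= m01 <-]; have [m2|m2] := leP m (1 / 2).
- have := fmid 0 (2 * m); have := f_sup (2 * m); rewrite f0.
  have -> : (0 + 2 * m) / 2 = m by lra.
  by move=> h1 h2; have := h1 ltac:(lra); have := h2 ltac:(lra) ltac:(lra); lra.
- have := fmid (2 * m - 1) 1; have := f_sup (2 * m - 1); rewrite f1.
  have -> : (2 * m - 1 + 1) / 2 = m by lra.
  by move=> h1 h2; have := h1 ltac:(lra); have := h2 ltac:(lra) ltac:(lra); lra.
Qed.

(** Subtracting the chord gives a function [g] that vanishes at both ends and is still strictly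
    midpoint convex. The upper bound on the segment makes it nonpositive, and one more midpoint step
    makes it negative. *)
Lemma midpoint_strictly_convex (f : R -> R) :
  (forall a b, a < b -> f ((a + b) / 2) < (f a + f b) / 2) ->
  (forall a b, a < b -> exists K, forall t, a < t < b -> f t <= K) ->
  forall a b l, a != b -> 0 < l < 1 ->
  f ((1 - l) * a + l * b) < (1 - l) * f a + l * f b.
Proof.
move=> fmid fbd a b l; wlog ab : a b l / a < b => [hw|_ l01].
  rewrite neq_lt => /orP[|] ab l01; first by apply: hw; rewrite ?lt_eqF.
  have := hw b a (1 - l) ab; rewrite lt_eqF// opprB subrKC => h.
  by rewrite addrC [ltRHS]addrC; apply: h => //; lra.
pose g m := f ((1 - m) * a + m * b) - ((1 - m) * f a + m * f b).
have gmid k m : k < m -> g ((k + m) / 2) < (g k + g m) / 2.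
  move=> km; have := fmid ((1 - k) * a + k * b) ((1 - m) * a + m * b).
  have -> : ((1 - k) * a + k * b + ((1 - m) * a + m * b)) / 2 =
    (1 - (k + m) / 2) * a + (k + m) / 2 * b by field.
  move=> h; have /h : (1 - k) * a + k * b < (1 - m) * a + m * b by nra.
  by rewrite /g; lra.
have g0 : g 0 = 0 by rewrite /g subr0 !mul1r !mul0r !addr0 subrr.
have g1 : g 1 = 0 by rewrite /g subrr !mul1r !mul0r !add0r subrr.
have [K fK] := fbd _ _ ab.
have gle0 m : 0 <= m <= 1 -> g m <= 0.
  apply: (midpoint_convex_le0 _ (`|K| + `|f a| + `|f b|)) => // [k k' _ _|k k01].
    have [kk'|kk'|->] := ltgtP k k'; first exact/ltW/gmid.
      by rewrite addrC [g k + _]addrC; exact/ltW/gmid.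
    have -> : (k' + k') / 2 = k' by lra.
    lra.
  have na := ler_norm (- f a); have nb := ler_norm (- f b); have nK := ler_norm K.
  rewrite !normrN in na nb.
  have na0 := normr_ge0 (f a); have nb0 := normr_ge0 (f b).
  have nK0 := normr_ge0 K.
  have [->|k0] := eqVneq k 0; first by rewrite g0; lra.
  have [->|k1] := eqVneq k 1; first by rewrite g1; lra.
  have : f ((1 - k) * a + k * b) <= K.
    by apply: fK; apply/andP; split; rewrite -subr_gt0; nra.
  have : - ((1 - k) * f a) <= `|f a| by nra.
  have : - (k * f b) <= `|f b| by nra.
  by rewrite /g; lra.
suff : g l < 0 by rewrite /g subr_lt0.
(* The largest [h] for which [l - h] and [l + h] stay in [[0, 1]], where [g] is already
   nonpositive. *)
pose h := Num.min l (1 - l).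
have h0 : 0 < h by rewrite /h lt_min; lra.
have hl : h <= l by rewrite /h ge_min lexx.
have hl' : h <= 1 - l by rewrite /h ge_min lexx orbT.
have := gmid (l - h) (l + h); have -> : (l - h + (l + h)) / 2 = l by lra.
have := gle0 (l - h); have := gle0 (l + h) => h1 h2 h3.
have := h1 ltac:(lra); have := h2 ltac:(lra); have := h3 ltac:(lra); lra.
Qed.

End MidpointConvexity.

(** * Semi-metrics with a prescribed infinitely remote point *)

Section SemiMetric.
Context {R : realType}.
Implicit Types (d : circle R -> circle R -> \bar R) (p q x y z u v o w : circle R).

Lemma distC d x y : semi_metric d -> dist d x y = dist d y x.
Proof. by move=> [dC _ _ _ _]; rewrite /dist dC. Qed.

Lemma distxx d x : semi_metric d -> dist d x x = 0.
Proof. by move=> [_ d0 _ _ _]; rewrite /dist d0. Qed.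

Lemma dist_gt0 d x y : semi_metric d -> x <> y -> 0 < dist d x y.
Proof.
move=> [_ _ d0 _ _] /d0; rewrite /dist; case: (d x y) => [r| |]//=.
Qed.

Lemma third_point x y : x <> y -> exists z, z <> x /\ z <> y.
Proof.
move=> xy; have [z _ /lt0r_neq0/side_neq[_ zx zy]] :=
  side_near x y setT xy openT (or_introl I).
by exists z.
Qed.

(* As dist replaces infinite distances by 1, the formula is also correct when d
   itself has an infinitely remote point. *)
Definition normalize d w x y : \bar R :=
  if x == y then 0%E else if (x == w) || (y == w) then +oo%E
  else (dist d x y / (dist d x w * dist d y w))%:E.

Lemma normalize_remote d w : infinitely_remote (normalize d w) w.
Proof. by move=> x /eqP/negPf xw; rewrite /normalize xw eqxx orbT. Qed.

Lemma normalize_semi_metric d w : semi_metric d -> semi_metric (normalize d w).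
Proof.
move=> dm; split.
- move=> x y; rewrite /normalize eq_sym orbC; case: eqP => // _.
  by case: ifP => // _; rewrite distC// [dist d x w * _]mulrC.
- by move=> x; rewrite /normalize eqxx.
- move=> x y xy; rewrite /normalize; case: eqP => // _; case: ifP => // /norP[xw yw].
  by rewrite lte_fin divr_gt0 ?mulr_gt0 ?dist_gt0//; exact/eqP.
- move=> x y; rewrite /normalize; case: eqP => // _; case: ifP => // + _.
  by move=> /orP[]/eqP->; [left|right]; exact: normalize_remote.
(* A point [u] other than [w] has finite distance to any third point, so [w] alone is infinitely
   remote. *)
- move=> v v'; have h u : infinitely_remote (normalize d w) u -> u = w.
    move=> hu; apply: contrapT => uw; have [z [zu zw]] := third_point _ _ uw.
    move: (hu z zu); rewrite /normalize.
    by move: zu zw uw => /eqP/negPf-> /eqP/negPf-> /eqP/negPf->.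
  by move=> /h-> /h->.
Qed.

(** The factor at [w] is 1: an infinite distance counts as 1 in [dist], and [|wy|] cancels against
    the factor at [y]. *)
Lemma dist_normalize d w x y : semi_metric d -> x <> y ->
  dist (normalize d w) x y = dist d x y *
    (if x == w then 1 else (dist d x w)^-1) * (if y == w then 1 else (dist d y w)^-1).
Proof.
move=> dm; rewrite {1}/dist /normalize; have [//|xy _] := eqVneq x y.
have [e|xw] := eqVneq x w => /=.
  move: xy; rewrite e => wy; rewrite mulr1 eq_sym (negPf wy) distC// divff//.
  by rewrite gt_eqF// dist_gt0//; apply/eqP; rewrite eq_sym.
have [e|yw] := eqVneq y w => /=.
  by rewrite mulr1 e divff// gt_eqF// dist_gt0//; exact/eqP.
by rewrite invfM mulrA.
Qed.

(** Normalizing multiplies distances by one nonzero factor per point, and each factor cancels in a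
    cross-ratio. *)
Lemma normalize_moebius d w : semi_metric d -> moebius_equiv d (normalize d w).
Proof.
move=> dm x1 x2 x3 x4; rewrite /= !inE !negb_or.
move=> /and4P[/and3P[/eqP x12 /eqP x13 /eqP x14] /andP[/eqP x23 /eqP x24] /eqP x34 _].
rewrite /cross_ratio !dist_normalize//.
have h x : (if x == w then 1 else (dist d x w)^-1) != 0.
  have [_|xw] := eqVneq x w; first exact: oner_neq0.
  by rewrite invr_neq0// gt_eqF// dist_gt0//; exact/eqP.
have n x y : x <> y -> dist d x y != 0 by move=> xy; rewrite gt_eqF// dist_gt0.
have := h x1; have := h x2; have := h x3; have := h x4.
have := n _ _ x14; have := n _ _ x23.
move: (if x1 == w then _ else _) (if x2 == w then _ else _) => l1 l2.
move: (if x3 == w then _ else _) (if x4 == w then _ else _) => l3 l4.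
move=> n23 n14 n4 n3 n2 n1; field.
by rewrite n23 n14 n4 n3 n2 n1.
Qed.

End SemiMetric.

Lemma set2_eq (T : Type) (p q z u : T) : [set p; q] = [set z; u] ->
  (z = p /\ u = q) \/ (z = q /\ u = p).
Proof.
move=> /seteqP[h1 h2].
have [hz hu] := (h2 z (or_introl erefl), h2 u (or_intror erefl)).
have [hp hq] := (h1 p (or_introl erefl), h1 q (or_intror erefl)).
by case: hz => hz; case: hu => hu; case: hp => hp; case: hq => hq; subst;
  first [by left|by right].
Qed.

(** * Distance ratios in a monotone structure *)

Section Moebius.
Context {R : realType}.
Implicit Types (p q x y z u v o w : circle R).
Context (M : set (circle R -> circle R -> \bar R)) (hM : moebius_structure M).

Lemma moebius_semi_metric d : M d -> semi_metric d.
Proof. by case: hM => d0 _ -> []. Qed.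

Lemma normalize_mem d w : M d -> M (normalize d w).
Proof.
case: hM => d0 _ -> [dm d0d]; split; first exact: normalize_semi_metric.
by move=> x1 x2 x3 x4 u; rewrite d0d// -normalize_moebius.
Qed.

Context (hmon : monotone_moebius M) (d : circle R -> circle R -> \bar R) (hd : M d).
Let dm : semi_metric d := moebius_semi_metric _ hd.

Lemma dist_monotone x y z u : x <> y -> z <> u -> separate [set x; y] [set z; u] ->
  dist d x z * dist d y u < dist d x y * dist d z u.
Proof. by move=> xy zu h; have := hmon.2 _ hd _ _ _ _ h; rewrite gt_max => /andP[]. Qed.

(* This is the ball of radius k / |pq| around p for the semi-metric with
   infinitely remote point q. *)
Lemma open_dist_ratio p q (k : R) : p <> q ->
  open [set y | dist d p y < k * dist d q y].
Proof.
move=> pq; have pq0 : 0 < dist d p q by exact: dist_gt0.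
have [k0|k0] := ltP 0 k; last first.
  rewrite [X in open X](_ : _ = set0); first exact: open0.
  apply/seteqP; split=> // y /=; apply/negP; rewrite -leNgt.
  have h x : 0 <= dist d x y.
    by have [->|/eqP xy] := eqVneq x y; [rewrite distxx|rewrite ltW// dist_gt0].
  by apply: le_trans (h p); rewrite mulr_le0_ge0.
rewrite -hmon.1; set B := [set y | _].
exists [set B]; last by rewrite bigcup_set1.
move=> _ ->; apply: (@finI_from1 _ _ (M_subbase M) id).
exists (normalize d q), q, p, (k / dist d p q); split=> //.
- exact: normalize_mem.
- exact: normalize_remote.
- by rewrite divr_gt0.
have ratioE y : y != q -> (dist d p y / (dist d p q * dist d y q) < k / dist d p q)
    = (dist d p y < k * dist d q y).
  move=> /eqP/nesym qy; rewrite [dist d y q]distC// invfM [(dist d p q)^-1 * _]mulrC.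
  by rewrite mulrA ltr_pM2r ?invr_gt0// ltr_pdivrMr// dist_gt0.
have /eqP/negPf pqF := pq.
apply/seteqP; split=> y; rewrite /B /= /normalize pqF /=.
  have [<- _|py] := eqVneq p y; first by rewrite lte_fin divr_gt0.
  have [->|yq] := eqVneq y q; last by rewrite lte_fin ratioE.
  by rewrite distxx// mulr0 ltNge ltW.
have [<- _|py] := eqVneq p y; first by rewrite distxx// mulr_gt0// distC.
by have [//|yq] := eqVneq y q; rewrite lte_fin ratioE.
Qed.

(** An intermediate value argument: the points with ratio below [k] and those with ratio above [k]
    form disjoint open sets, one meeting the arc near [p] and the other near [q]. If no ratio
    equalled [k], they would disconnect the arc. *)
Lemma dist_ratio_onto_side p q (k : R) : p <> q -> 0 < k ->
  exists2 y, 0 < side p q y & dist d p y = k * dist d q y.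
Proof.
move=> pq k0; apply: contrapT => hno.
pose U := [set y | dist d p y < k * dist d q y].
pose V := [set y | dist d q y < k^-1 * dist d p y].
have VE y : V y <-> k * dist d q y < dist d p y.
  by rewrite /V /= mulrC ltr_pdivlMr// mulrC.
have [a Ua a0] : exists2 a, U a & 0 < side p q a.
  apply: side_near => //; first exact: open_dist_ratio.
  by left; rewrite /U /= distxx// mulr_gt0// dist_gt0//; exact: nesym.
have [b Vb b0] : exists2 b, V b & 0 < side p q b.
  apply: side_near => //; first exact/open_dist_ratio/nesym.
  by right; rewrite /V /= distxx// mulr_gt0 ?invr_gt0// dist_gt0.
suff : [set y | 0 < side p q y] `&` U = [set y | 0 < side p q y].
  move=> /seteqP[_ /(_ _ b0)[_]]; rewrite /U /=.
  by move/VE : Vb => h1 h2; have := lt_trans h1 h2; rewrite ltxx.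
apply: (connected_side p q pq); first by exists a.
  by exists U => //; exact: open_dist_ratio.
exists (~` V); first exact/open_closedC/open_dist_ratio/nesym.
apply/seteqP; split=> y /= [y0 Uy]; split=> //.
  by move/VE => h; have := lt_trans h Uy; rewrite ltxx.
have := Uy; rewrite VE => /negP; rewrite -leNgt le_eqVlt => /orP[/eqP e|//].
by case: hno; exists y.
Qed.

Lemma dist_ratio_onto p q v (k : R) : side p q v != 0 -> 0 < k ->
  exists2 y, side p q y * side p q v < 0 & dist d p y = k * dist d q y.
Proof.
move=> v0; have [pq _ _] := side_neq _ _ _ v0 => k0.
move: v0; rewrite neq_lt => /orP[v0|v0].
  have [y y0 e] := dist_ratio_onto_side _ _ _ pq k0.
  by exists y => //; rewrite pmulr_rlt0.
(* The other arc is the positive side for the chord taken from [q] to [p], for which the ratio is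
   inverted. *)
have ki0 : 0 < k^-1 by rewrite invr_gt0.
have [y y0 e] := dist_ratio_onto_side _ _ _ (nesym pq) ki0.
exists y; first by rewrite sideC nmulr_rlt0// oppr_lt0.
by rewrite e mulrA divff ?mul1r// gt_eqF.
Qed.

(* The event of the timelike line of {p, q} with time coordinate s. *)
Definition level p q (s : R) := [set y | dist d p y = expR s * dist d q y].

Definition log_dist x y : R := ln (dist d x y).

Lemma log_distC x y : log_dist x y = log_dist y x.
Proof. by rewrite /log_dist distC. Qed.

Definition log_ratio p q x : R := log_dist p x - log_dist q x.

Lemma dist_pos x y : x <> y -> dist d x y \is Num.pos.
Proof. by move=> xy; rewrite qualifE/= dist_gt0. Qed.

Lemma level_log_ratio p q x : x <> p -> x <> q -> level p q (log_ratio p q x) x.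
Proof.
move=> /nesym px /nesym qx; rewrite /level /log_ratio /log_dist /= expRD expRN.
by rewrite !lnK ?dist_pos// divfK// gt_eqF// dist_gt0.
Qed.

Lemma log_ratio_level p q s x : p <> q -> level p q s x ->
  [/\ x <> p, x <> q & log_ratio p q x = s].
Proof.
rewrite /level /= => pq h.
have xq : x <> q.
  by move=> e; move: h; rewrite e distxx// mulr0 => /eqP; rewrite gt_eqF// dist_gt0.
have xp : x <> p.
  move=> e; move: h; rewrite e distxx// => /esym/eqP.
  by rewrite gt_eqF// mulr_gt0 ?expR_gt0// dist_gt0//; exact: nesym.
split=> //; rewrite /log_ratio /log_dist h lnM ?dist_pos ?expRK ?addrK//; last exact: nesym.
by rewrite qualifE/= expR_gt0.
Qed.

(** In the opposite order, monotonicity for [{p, x}] and [{y, q}] would give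
    [|py| |xq| < |px| |yq|], that is [t < s]. So time increases along an arc from [p] to [q]. *)
Lemma level_separate p q s t x y : 0 < side p q x * side p q y ->
  level p q s x -> level p q t y -> s < t -> separate [set p; y] [set x; q].
Proof.
move=> xy xs yt st; have : side p q x * side p q y != 0 by rewrite gt_eqF.
rewrite mulf_eq0 negb_or => /andP[/side_neq[pq xp xq] /side_neq[_ yp yq]].
have xNy : x <> y.
  move=> e; move: yt; rewrite -e => /(log_ratio_level _ _ _ _ pq)[_ _].
  by have [_ _ ->] := log_ratio_level _ _ _ _ pq xs; move: st => /[swap]->; rewrite ltxx.
have [//|/dist_monotone] := side_order p q x y xNy xy.
move=> /(_ (nesym xp) yq); rewrite xs yt -!mulrA [dist d q y * _]mulrC.
rewrite (distC d x q)// (distC d y q)//.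
rewrite ltr_pM2r; first by rewrite ltr_expR ltNge ltW.
by rewrite mulr_gt0// dist_gt0//; exact: nesym.
Qed.

(** Distinct points of one arc come in some order, and monotonicity then makes their ratios
    differ. *)
Lemma level_unique p q s x y : 0 < side p q x * side p q y ->
  level p q s x -> level p q s y -> x = y.
Proof.
wlog: x y / separate [set p; y] [set x; q] => [hw xy xs ys|sep xy xs ys].
  apply: contrapT => xNy; case: (side_order p q x y xNy xy) => h.
    by apply/xNy/hw.
  by apply/xNy/esym/hw => //; rewrite mulrC.
have : side p q x * side p q y != 0 by rewrite gt_eqF.
rewrite mulf_eq0 negb_or => /andP[/side_neq[pq xp xq] /side_neq[_ yp yq]].
have := dist_monotone _ _ _ _ (nesym yp) xq sep; rewrite xs ys.
by rewrite (distC d x q)// (distC d y q)// mulrAC ltxx.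
Qed.

Lemma level_pair p q s x x' : side p q x * side p q x' < 0 ->
  level p q s x -> level p q s x' -> level p q s = [set x; x'].
Proof.
move=> xx' xs x's; have [pq xp xq _ _] := side_lt0_neq _ _ _ _ xx'.
apply/seteqP; split=> y; last by case=> ->.
move=> ys; have [yp yq _] := log_ratio_level _ _ _ _ pq ys.
have := side_neq0 _ _ _ pq yp yq; have := side_neq0 _ _ _ pq xp xq.
rewrite !neq_lt => /orP[] x0 /orP[] y0.
- by left; apply: level_unique ys xs; rewrite nmulr_rgt0.
- right; apply: level_unique ys x's; rewrite pmulr_rgt0//.
  by move: xx'; rewrite nmulr_rlt0.
- right; apply: level_unique ys x's; rewrite nmulr_rgt0//.
  by move: xx'; rewrite pmulr_rlt0.
- by left; apply: level_unique ys xs; rewrite pmulr_rgt0.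
Qed.

Lemma level_on_arc p q v s : side p q v != 0 ->
  exists2 y, side p q y * side p q v < 0 & level p q s y.
Proof. by move=> v0; apply: dist_ratio_onto v0 (expR_gt0 s); eassumption. Qed.

Lemma level_exists p q s : p <> q -> exists y, level p q s y.
Proof.
move=> pq; have [v [vp vq]] := third_point _ _ pq.
by have [y _ ys] := level_on_arc _ _ _ s (side_neq0 _ _ _ pq vp vq); exists y.
Qed.

(** * Timelike lines and their time coordinate *)

Lemma timelikeP p q f : p <> q ->
  timelike d [set p; q] f <-> exists s, f = level p q s.
Proof.
move=> pq; split=> [[x [y [z [u [xyzu e -> exyzu]]]]]|[s ->]].
  move: xyzu; rewrite /= !inE !negb_or.
  move=> /and4P[/and3P[/eqP xy /eqP xz /eqP xu] /andP[/eqP yz /eqP yu] _ _].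
  have [xp xq yp yq exy] : [/\ x <> p, x <> q, y <> p, y <> q &
      dist d p x * dist d q y = dist d q x * dist d p y].
    case: (set2_eq _ _ _ _ _ e) => -[ez eu]; subst z u; split=> //.
      by rewrite !(distC d _ x)// !(distC d _ y).
    by rewrite !(distC d _ x)// !(distC d _ y)// exyzu.
  exists (log_ratio p q x).
  have xs := level_log_ratio _ _ _ xp xq.
  have ys : level p q (log_ratio p q x) y.
    move: xs; rewrite /level /= => xs.
    apply: (@mulfI _ (dist d q x)); first by rewrite gt_eqF// dist_gt0//; exact: nesym.
    by rewrite -exy xs; ring.
  (* Two points of equal ratio on the same arc would coincide, so [x] and [y] lie on different
     arcs. *)
  apply/esym/level_pair => //; rewrite ltNge le_eqVlt; apply/negP => /orP[|h].
    rewrite eq_sym mulf_eq0 => /orP[]; apply/negP; exact: side_neq0.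
  by apply: xy; apply: level_unique h xs ys.
have [v [vp vq]] := third_point _ _ pq.
have [x xv xs] := level_on_arc _ _ _ s (side_neq0 _ _ _ pq vp vq).
have [_ xp xq _ _] := side_lt0_neq _ _ _ _ xv.
(* [y] is chosen on the arc opposite to [x]: a level has one point on each arc. *)
have [y yx ys] := level_on_arc _ _ _ s (side_neq0 _ _ _ pq xp xq).
have [_ yp yq _ _] := side_lt0_neq _ _ _ _ yx.
exists y, x, p, q; split=> //.
- rewrite /= !inE !negb_or andbT; apply/and3P; split; last exact/eqP.
  + apply/and3P; split; apply/eqP => // e.
    by move: yx; rewrite e -expr2 ltNge sqr_ge0.
  + by apply/andP; split; exact/eqP.
- exact: level_pair.
- by rewrite !(distC d y)// !(distC d x)// xs ys; ring.
Qed.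

Lemma timelike_eventE p q x : x <> p -> x <> q -> p <> q ->
  timelike_event d [set p; q] x = level p q (log_ratio p q x).
Proof.
move=> xp xq pq; apply: xget_unique => [|_ [/(timelikeP _ _ _ pq)[s ->] xs]].
  by split; [apply/timelikeP => //; eexists|exact: level_log_ratio].
by have [_ _ ->] := log_ratio_level _ _ _ _ pq xs.
Qed.

Lemma time_level p q s t : p <> q ->
  time d [set p; q] (level p q s) (level p q t) = `|s - t|.
Proof.
move=> pq.
have h x y z z' : [set p; q] = [set x; y] -> level p q s z -> level p q t z' ->
    `|ln ((dist d x z' * dist d y z) / (dist d x z * dist d y z'))| = `|s - t|.
  move=> e zs z't.
  have [/nesym zp /nesym zq <-] := log_ratio_level _ _ _ _ pq zs.
  have [/nesym z'p /nesym z'q <-] := log_ratio_level _ _ _ _ pq z't.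
  have k a b a' b' : a <> b -> a' <> b' ->
      ln (dist d a b * dist d a' b') = ln (dist d a b) + ln (dist d a' b').
    by move=> ab a'b'; rewrite lnM ?dist_pos.
  have kpos a b a' b' : a <> b -> a' <> b' -> dist d a b * dist d a' b' \is Num.pos.
    by move=> ab a'b'; rewrite qualifE/= mulr_gt0 ?dist_gt0.
  rewrite /log_ratio /log_dist.
  (* Exchanging the two ends of the event inverts the quotient, so its logarithm only changes
     sign. *)
  case: (set2_eq _ _ _ _ _ e) => -[-> ->]; rewrite ln_div ?kpos// !k//.
    by rewrite -normrN; congr `| _ |; ring.
  by congr `| _ |; ring.
apply: xget_unique => [|_ [x [y [z [z' [e zs z't ->]]]]]]; last exact: h.
have [z zs] := level_exists p q s pq; have [z' z't] := level_exists p q t pq.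
by exists p, q, z, z'; split=> //; rewrite h.
Qed.

Lemma level_inj p q : p <> q -> injective (level p q).
Proof.
move=> pq s t e; have [x xs] := level_exists p q s pq.
have xt : level p q t x by rewrite -e.
have [_ _ <-] := log_ratio_level _ _ _ _ pq xs.
by have [_ _ <-] := log_ratio_level _ _ _ _ pq xt.
Qed.

Lemma level_parametrization p q : p <> q ->
  isometric_parametrization d [set p; q] (level p q).
Proof.
move=> pq; split; last by move=> s s'; exact: time_level.
split=> [s _|s t _ _|f].
- by apply/timelikeP => //; exists s.
- exact: level_inj.
- by move=> /(timelikeP _ _ _ pq)[s ->]; exists s.
Qed.

Lemma arc_offE p q v v' : 0 < side p q v * side p q v' ->
  arc_off [set p; q] [set v; v'] = [set x | side p q x * side p q v < 0].
Proof.
move=> vv'; have : side p q v * side p q v' != 0 by rewrite gt_eqF.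
rewrite mulf_eq0 negb_or => /andP[v0 v'0].
have [pq vp vq] := side_neq _ _ _ v0.
apply/seteqP; split=> x.
  move=> [xpq /seteqP[xv _]].
  have x0 : side p q x != 0.
    by apply: side_neq0 => // e; apply: xpq; rewrite e; [left|right].
  rewrite /= ltNge le_eqVlt eq_sym mulf_eq0 (negPf x0) (negPf v0) /=.
  by apply/negP => h; apply: (xv v); split; [exact/component_side|left].
rewrite /= => xv; have [_ xp xq _ _] := side_lt0_neq _ _ _ _ xv.
have x0 := side_neq0 _ _ _ pq xp xq.
split; first by case.
apply/seteqP; split=> // y [/(component_side _ _ _ _ x0) xy yv].
case: yv xy => -> xv'; first by have := lt_trans xv' xv; rewrite ltxx.
have : 0 < (side p q x * side p q v') * (side p q v * side p q v') by rewrite mulr_gt0.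
rewrite mulrACA -expr2 ltNge => /negP[].
by rewrite mulr_le0_ge0 ?sqr_ge0// ltW.
Qed.

(** On one arc the time coordinate determines the point, so ['pinv_] in [F_ab_lines] recovers the
    point of the arc from its event. *)
Lemma timelike_event_inj p q v : side p q v != 0 ->
  {in [set x | side p q x * side p q v < 0] &, injective (timelike_event d [set p; q])}.
Proof.
move=> v0 x y; rewrite !inE /= => xv yv.
have [pq xp xq _ _] := side_lt0_neq _ _ _ _ xv.
have [_ yp yq _ _] := side_lt0_neq _ _ _ _ yv.
rewrite !timelike_eventE// => /(level_inj _ _ pq) e.
have xs := level_log_ratio _ _ _ xp xq.
have ys := level_log_ratio _ _ _ yp yq.
apply: (level_unique p q (log_ratio p q x)) => //; last by rewrite e.
have : 0 < (side p q x * side p q v) * (side p q y * side p q v) by rewrite nmulr_rgt0.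
by rewrite mulrACA -expr2 pmulr_lgt0// exprn_even_gt0.
Qed.

(** * Logarithmic forms of monotonicity and of [delta] *)

Context (hC : convexity_axiom M).

Local Notation L := log_dist.

(* Twice the part of F_ab depending on x, for a = {p, q} and b = {v, v'}. *)
Definition half_F p q v v' x : R :=
  L v x + L v' x - L p x - L q x.

Lemma cyclic_order_ln x y z u : cyclic_order [:: x; z; y; u] ->
  L x z + L y u < L x y + L z u /\ L x u + L y z < L x y + L z u.
Proof.
move=> cyc; have := cyclic_order_uniq [:: x; z; y; u] isT cyc.
rewrite /= !inE !negb_or.
move=> /and4P[/and3P[/eqP xz /eqP xy /eqP xu] /andP[/eqP zy /eqP zu] /eqP yu _].
have lnM_dist a b a' b' : a <> b -> a' <> b' ->
    ln (dist d a b * dist d a' b') = L a b + L a' b'.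
  by move=> ab a'b'; rewrite lnM ?dist_pos.
have pos a b a' b' : a <> b -> a' <> b' -> dist d a b * dist d a' b' \is Num.pos.
  by move=> ab a'b'; rewrite qualifE/= mulr_gt0 ?dist_gt0.
have sep := cyclic_order_separate _ _ _ _ cyc.
split; rewrite -!lnM_dist ?ltr_ln ?pos//; try exact: nesym.
  exact: dist_monotone.
rewrite (distC d z u)//; apply: dist_monotone => //; first exact: nesym.
by rewrite [[set u; z]]setUC.
Qed.

Lemma ln_delta x y z t : t <> x -> t <> y -> t <> z ->
  ln (delta d x y z t) = L t y *+ 2 - (L t x + L t z).
Proof.
move=> tx ty tz; rewrite /delta ln_div ?qualifE/= ?exprn_gt0 ?mulr_gt0 ?dist_gt0//.
all: try exact: nesym.
rewrite lnXn ?dist_gt0//; last exact: nesym.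
by rewrite lnM ?dist_pos// /log_dist; try exact: nesym; rewrite !(distC d t).
Qed.

(** * Strict convexity along an arc [X] parametrized by time *)

Section OnArc.
Context (p q v v' : circle R) (X : R -> circle R)
  (vv' : 0 < side p q v * side p q v')
  (Xv : forall s, side p q (X s) * side p q v < 0)
  (Xlevel : forall s, level p q s (X s)).

Let pq : p <> q.
Proof. by have [] := side_lt0_neq _ _ _ _ (Xv 0). Qed.

Lemma same_side_lt0 x : side p q x * side p q v < 0 -> side p q x * side p q v' < 0.
Proof.
move=> xv; rewrite ltNge; apply/negP => xv'.
have v0 : 0 < side p q v ^+ 2.
  by rewrite exprn_even_gt0//=; apply/eqP => e; move: vv'; rewrite e mul0r ltxx.
have : side p q x * side p q v * (side p q v * side p q v') < 0.
  by rewrite pmulr_llt0.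
rewrite (_ : _ * _ = side p q v ^+ 2 * (side p q x * side p q v')); last by ring.
by rewrite pmulr_rlt0// ltNge xv'.
Qed.

Lemma cyclic_order_level s t r u : u = v \/ u = v' -> s < t -> t < r ->
  cyclic_order [:: p; X s; X t; X r; q; u].
Proof.
move=> uv st tr; have Xu a : side p q (X a) * side p q u < 0.
  by case: uv => ->; [exact: Xv|exact: same_side_lt0].
have XX a b : 0 < side p q (X a) * side p q (X b).
  have : 0 < (side p q (X a) * side p q v) * (side p q (X b) * side p q v).
    by rewrite nmulr_rgt0.
  rewrite mulrACA -expr2 pmulr_lgt0// exprn_even_gt0//=.
  by apply/eqP => e; move: vv'; rewrite e mul0r ltxx.
apply: cyclic_order_arc => //.
- exact: (level_separate _ _ s t).
- exact: (level_separate _ _ t r).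
Qed.

Lemma Llevel s : L p (X s) = s + L q (X s).
Proof.
have [_ _] := log_ratio_level _ _ _ _ pq (Xlevel s).
by move=> /(canRL (subrK _)).
Qed.

Lemma delta_level s r t u : u = v \/ u = v' -> s < r -> t = (s + r) / 2 ->
  L u (X t) *+ 2 - (L u (X s) + L u (X r)) <
  L q (X t) *+ 2 - (L q (X s) + L q (X r)).
Proof.
move=> uv sr tE; have [st tr] : s < t /\ t < r by lra.
have cyc := cyclic_order_level s t r u uv st tr.
have unq := cyclic_order_uniq [:: p; X s; X t; X r; q; u] isT cyc.
have := unq; rewrite /= !inE !negb_or.
move=> /and5P[/and5P[/eqP ps /eqP pt /eqP pr _ _] /and4P[/eqP xt /eqP xr /eqP sq /eqP su]].
move=> /and3P[/eqP tr' /eqP tq /eqP tu] /andP[/eqP rq /eqP ru] _.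
(* The Convexity Axiom is used with [p] as [o'], [q] as [o] and [u] as the sixth point. *)
have := hC _ hd _ _ _ _ _ _ unq cyc.
have dpos y : y <> X s -> y <> X t -> y <> X r ->
    delta d (X s) (X t) (X r) y \is Num.pos.
  move=> ys yt yr; rewrite qualifE/= /delta divr_gt0 ?exprn_gt0 ?mulr_gt0//;
    rewrite ?dist_gt0//; exact: nesym.
have dq := dpos q (nesym sq) (nesym tq) (nesym rq).
have dp := dpos p ps pt pr.
have du := dpos u (nesym su) (nesym tu) (nesym ru).
rewrite -ltr_ln// => h.
rewrite -!ln_delta//; try exact: nesym.
(* Its hypothesis holds because [ln |pX(s)| = s + ln |qX(s)|]: the logarithms of [delta] at [p] and
   [q] differ by [2 t - (s + r)], which is 0 at the midpoint. *)
apply: h; apply: (can_in_inj (@lnK R)) => //.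
rewrite !ln_delta//; try exact: nesym.
rewrite !Llevel tE; lra.
Qed.

Lemma half_F_strictly_convex s r l : s != r -> 0 < l < 1 ->
  half_F p q v v' (X ((1 - l) * s + l * r)) <
  (1 - l) * half_F p q v v' (X s) + l * half_F p q v v' (X r).
Proof.
apply: (midpoint_strictly_convex (fun s => half_F p q v v' (X s))) => a b ab.
  (* The inequalities for [v] and [v'] are added; [L p + L q] equals [2 L q] up to the affine term
     [s]. *)
  have := delta_level a b _ v (or_introl erefl) ab erefl.
  have := delta_level a b _ v' (or_intror erefl) ab erefl.
  rewrite /half_F !Llevel /=; lra.
(* By monotonicity, [L v - L p] at [X t] is smaller than at [X a], and [L v' - L q] at [X t] is
   smaller than at [X b]. *)
exists ((L v (X a) - L p (X a)) + (L v' (X b) - L q (X b))) => t /andP[at_ tb].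
have sub1 : subseq [:: p; X a; X t; v] [:: p; X a; X t; X b; q; v].
  by apply/subseqP; exists [:: true; true; true; false; false; true].
have sub2 : subseq [:: X t; X b; q; v'] [:: p; X a; X t; X b; q; v'].
  by apply/subseqP; exists [:: false; false; true; true; true; true].
have := cyclic_order_level a t b v (or_introl erefl) at_ tb.
move=> /(cyclic_order_subseq _ _ sub1)/cyclic_order_ln[+ _].
have := cyclic_order_level a t b v' (or_intror erefl) at_ tb.
move=> /(cyclic_order_subseq _ _ sub2)/cyclic_order_ln[_ +].
rewrite /half_F (log_distC v (X t)) (log_distC v (X a)) (log_distC q (X t)).
rewrite (log_distC v' (X b)) (log_distC v' (X t)); lra.
Qed.

End OnArc.

Lemma F_ab_half_F o o' w w' x x' : cyclic_order [:: o; x; o'; w'; x'; w] ->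
  F_ab d o o' w w' [set x; x'] =
  2^-1 * (half_F o o' w w' x + half_F w w' o o' x').
Proof.
move=> cyc; have := cyclic_order_uniq [:: o; x; o'; w'; x'; w] isT cyc.
rewrite /= !inE !negb_or.
move=> /and5P[/and5P[/eqP ox _ _ /eqP ox' _] /and4P[/eqP xo' /eqP xw' /eqP xx' /eqP xw]].
move=> /and3P[_ /eqP o'x' _] /andP[/eqP w'x' _] /andP[/eqP x'w _].
have sub1 : subseq [:: o; x; x'; w] [:: o; x; o'; w'; x'; w].
  by apply/subseqP; exists [:: true; true; false; false; true; true].
have sub2 : subseq [:: x; o'; w'; x'] [:: o; x; o'; w'; x'; w].
  by apply/subseqP; exists [:: false; true; true; true; true; false].
(* Monotonicity on [o, x, x', w] and on [x, o', w', x'] shows that both differences of time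
   coordinates are negative. *)
have [+ _] := cyclic_order_ln _ _ _ _ (cyclic_order_subseq _ _ sub1 cyc).
have [+ _] := cyclic_order_ln _ _ _ _ (cyclic_order_subseq _ _ sub2 cyc).
rewrite /F_ab !(timelike_eventE)//; try exact: nesym.
rewrite !time_level// /log_ratio /half_F.
rewrite (log_distC x o) (log_distC x o') (log_distC x w) (log_distC x w').
rewrite (log_distC x' o) (log_distC x' o') (log_distC x' w) (log_distC x' w') => h1 h2; congr (_ * _).
rewrite ltr0_norm; last lra.
by rewrite ltr0_norm; lra.
Qed.



End Moebius.

(** * Convexity in both variables *)

Theorem proposition7p16 (R : realType)
  (M : set (circle R -> circle R -> \bar R))
  (hM : moebius_structure M) (hmon : monotone_moebius M) (hC : convexity_axiom M)
  (d : circle R -> circle R -> \bar R) (hd : M d)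
  (a b : set (circle R)) (ha : event a) (hb : event b)
  (hab : strong_causal a b)
  (o o' w w' : circle R) (hao : a = [set o; o']) (hbw : b = [set w; w'])
  (hlab : separate [set o; w'] [set o'; w]) :
  strictly_convex_on_lines d a b (F_ab_lines d o o' w w').
Proof.
have uniq_ends (e : set (circle R)) x y : event e -> e = [set x; y] -> x <> y.
  move=> [z [u [zu ->]]] zuxy xy; apply: zu.
  by case: (set2_eq _ _ _ _ _ zuxy) => -[<- <-]; rewrite xy.
have oo' := uniq_ends _ _ _ ha hao; have ww' := uniq_ends _ _ _ hb hbw.
have [ab0 _] := hab; subst a b.
have disj x : [set o; o'] x -> [set w; w'] x -> False.
  by move=> ax bx; have : ([set o; o'] `&` [set w; w']) x by []; rewrite ab0.
have u4 : uniq [:: o; o'; w; w'].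
  rewrite /= !inE !negb_or !andbT; apply/and3P; split; last exact/eqP.
    apply/and3P; split; apply/eqP => // e; apply: (disj o); rewrite ?e; by [left|right].
  apply/andP; split; apply/eqP => // e; apply: (disj o'); rewrite ?e; by [left|right].
have [sw so] := crossed_side _ _ _ _ u4 hlab.
have w0 : side o o' w != 0 by apply/eqP => e; move: sw; rewrite e mul0r ltxx.
have o0 : side w w' o != 0 by apply/eqP => e; move: so; rewrite e mul0r ltxx.
(* [X s] is the point with time coordinate [s] on the arc of the first event that avoids the second;
   [Y] plays the same role for the second event. *)
have /choice[X XP] : forall s, exists x,
    side o o' x * side o o' w < 0 /\ level d o o' s x.
  by move=> s; have [x] := level_on_arc _ hM hmon _ hd _ _ _ s w0; exists x.
have /choice[Y YP] : forall s, exists x,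
    side w w' x * side w w' o < 0 /\ level d w w' s x.
  by move=> s; have [x] := level_on_arc _ hM hmon _ hd _ _ _ s o0; exists x.
have FE s t : F_ab_lines d o o' w w' (level d o o' s) (level d w w' t) =
    2^-1 * (half_F d o o' w w' (X s) + half_F d w w' o o' (Y t)).
  have [Xs Xl] := XP s; have [Ys Yl] := YP t.
  rewrite /F_ab_lines (arc_offE _ _ _ _ sw) (arc_offE _ _ _ _ so).
  have [Xo Xo' eX] := log_ratio_level _ hM _ hd _ _ _ _ oo' Xl.
  have [Yw Yw' eY] := log_ratio_level _ hM _ hd _ _ _ _ ww' Yl.
  (* The levels [s] and [t] are the events through [X s] and [Y t], so the inverse bijections return
     these two points. *)
  rewrite -{1}eX -{1}eY -!(timelike_eventE _ hM hmon _ hd)// !pinvKV ?inE//.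
  - apply: (F_ab_half_F _ hM hmon _ hd); exact: cyclic_order_crossed.
  - exact: timelike_event_inj hM hmon _ hd _ _ _ o0.
  - exact: timelike_event_inj hM hmon _ hd _ _ _ w0.
exists (level d o o'), (level d w w'); split.
- exact: (level_parametrization _ hM hmon _ hd).
- exact: (level_parametrization _ hM hmon _ hd).
have cX := half_F_strictly_convex _ hM hmon _ hd hC _ _ _ _ X sw
  (fun s => (XP s).1) (fun s => (XP s).2).
have cY := half_F_strictly_convex _ hM hmon _ hd hC _ _ _ _ Y so
  (fun s => (YP s).1) (fun s => (YP s).2).
move=> s s' r r' l sr l01; rewrite !FE.
have same (t : R) : (1 - l) * t + l * t = t by ring.
(* When only one coordinate varies, the other summand is constant and the varying one supplies the
   strict inequality. *)
have [e|/cX/(_ l01) hX] := eqVneq s r; have [e'|/cY/(_ l01) hY] := eqVneq s' r'.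
- by case: sr; rewrite e e'.
- by rewrite e same; lra.
- by rewrite e' same; lra.
- by lra.
Qed.
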